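(* Any closed convex set $A\subseteq\mathbb{R}^n$ is directionally regular, i.e. $N_A(z;d)=N_A^i(z;d)$ for every $z\in A$ and every $d\in\mathbb{R}^n$.
   Context: For $C\subseteq\mathbb{R}^n$: the regular (Fréchet) normal cone is $\widehat N_C(z)=\{v:\langle v,z'-z\rangle\le o(\|z'-z\|)\ \forall z'\in C\}$ for $z\in C$, and $\widehat N_C(z)=\emptyset$ for $z\notin C$. For $z\in C$ and $d\in\mathbb{R}^n$, the directional limiting normal cone is $N_C(z;d)=\{v:\exists t_k\downarrow0,\ d_k\to d,\ v_k\to v\text{ with }v_k\in\widehat N_C(z+t_kd_k)\ \forall k\}$, and the inner directional limiting normal cone is $N^i_C(z;d)=\{v:\forall t_k\downarrow0\ \exists d_k\to d,\ v_k\to v\text{ with }v_k\in\widehat N_C(z+t_kd_k)\ \forall k\}$ ($t_k\downarrow0$ means $t_k>0$, $t_k\to0$). *)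

(* Defs.v *)
From mathcomp Require Import all_boot all_order all_algebra.
From mathcomp Require Import all_classical all_reals all_analysis.

Set Implicit Arguments.
Unset Strict Implicit.
Unset Printing Implicit Defensive.

Import Order.TTheory GRing.Theory Num.Theory.
Import numFieldNormedType.Exports.

Local Open Scope classical_set_scope.
Local Open Scope ring_scope.

Section NormalCones.
Context {R : realType} {n : nat}.
Implicit Types (C : set 'rV[R]_n) (z d u v : 'rV[R]_n).

Definition inner u v : R := \sum_(i < n) u 0 i * v 0 i.

(* The library norm on matrices is the maximum norm, hence this definition;
   both norms induce the library topology on 'rV[R]_n. *)
Definition enorm u : R := Num.sqrt (inner u u).

(* The function o is the remainder in <v, z' - z> <= o(||z' - z||); only its
   behaviour as its argument tends to 0 from the right is constrained. *)
Definition regular_normal_cone C z : set 'rV[R]_n :=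
  [set v | C z /\ exists2 o : R -> R, o =o_ (0^'+) id &
     forall z', C z' -> inner v (z' - z) <= o (enorm (z' - z))].

(* The arrow in t_k \downarrow 0 does not require t to be nonincreasing. *)
Definition tends_down0 (t : R^nat) : Prop :=
  (forall k, 0 < t k) /\ t @ \oo --> (0 : R).

Definition dir_normal_cone C z d : set 'rV[R]_n :=
  [set v | exists (t : R^nat) (dk vk : nat -> 'rV[R]_n),
     [/\ tends_down0 t, dk @ \oo --> d, vk @ \oo --> v &
         forall k, regular_normal_cone C (z + t k *: dk k) (vk k)]].

Definition inner_dir_normal_cone C z d : set 'rV[R]_n :=
  [set v | forall t : R^nat, tends_down0 t ->
     exists (dk vk : nat -> 'rV[R]_n),
     [/\ dk @ \oo --> d, vk @ \oo --> v &
         forall k, regular_normal_cone C (z + t k *: dk k) (vk k)]].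

Definition directionally_regular C : Prop :=
  forall z d, C z -> dir_normal_cone C z d = inner_dir_normal_cone C z d.

End NormalCones.

(* Main.v *)
(* After translating z to 0, the sets A / s increase as s decreases to 0.  Given
   v in N_A(z; d) and s_j -> 0, project d + v onto A / s_j: the projection p_j
   comes with the regular normal w_j = d + v - p_j.  In the limit the witnesses of
   v in N_A(z; d) give <v, p_j - d> <= 0, and their base points d_k eventually lie
   in A / s_j; together these give |p_j - d|^2 <= |d + v| |d_k - d|.  Hence p_j -> d
   and w_j -> v. *)
Require Import Defs.
From mathcomp Require Import all_boot all_order all_algebra.
From mathcomp Require Import all_classical all_reals all_analysis.
From mathcomp Require Import ring lra.
Import Order.TTheory GRing.Theory Num.Theory.
Import numFieldNormedType.Exports.

Set Implicit Arguments.
Unset Strict Implicit.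
Unset Printing Implicit Defensive.

Local Open Scope classical_set_scope.
Local Open Scope ring_scope.

Section InnerProduct.
Context {R : realType} {n : nat}.
Implicit Types (a : R) (u v w : 'rV[R]_n).

Lemma innerC u v : inner u v = inner v u.
Proof. by apply: eq_bigr => i _; rewrite mulrC. Qed.

Lemma innerDl u v w : inner (u + v) w = inner u w + inner v w.
Proof. by rewrite -big_split; apply: eq_bigr => i _; rewrite mxE mulrDl. Qed.

Lemma innerZl a u v : inner (a *: u) v = a * inner u v.
Proof. by rewrite /inner mulr_sumr; apply: eq_bigr => i _; rewrite mxE mulrA. Qed.

Lemma innerNl u v : inner (- u) v = - inner u v.
Proof. by rewrite -scaleN1r innerZl mulN1r. Qed.

Lemma innerDr u v w : inner u (v + w) = inner u v + inner u w.
Proof. by rewrite innerC innerDl !(innerC u). Qed.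

Lemma innerZr a u v : inner u (a *: v) = a * inner u v.
Proof. by rewrite innerC innerZl innerC. Qed.

Lemma innerNr u v : inner u (- v) = - inner u v.
Proof. by rewrite innerC innerNl innerC. Qed.

Definition innerE := (innerDl, innerDr, innerNl, innerNr, innerZl, innerZr).

Lemma inner_ge0 u : 0 <= inner u u.
Proof. by apply: sumr_ge0 => i _; rewrite -expr2 sqr_ge0. Qed.

(** The maximum norm is attained at an entry, whose square is one term of the sum. Through this
    bound, Euclidean estimates yield boundedness and convergence in the library norm. *)
Lemma mx_norm_sqr_le_inner u : `|u| ^+ 2 <= inner u u.
Proof.
have [->|u0] := eqVneq u 0; first by rewrite normr0 expr0n inner_ge0.
have [|[i j] /= uij] := @mx_norm_neq0 _ _ _ u; first by apply: contra_neq u0 => /mx_norm_eq0.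
rewrite [`|u|]uij (ord1 i) real_normK ?num_real// /inner (bigD1 j)//= -expr2 lerDl.
by apply: sumr_ge0 => k _; rewrite -expr2 sqr_ge0.
Qed.

Lemma inner_eq0 u : inner u u = 0 -> u = 0.
Proof.
move=> u0; apply/eqP; rewrite -normr_eq0 -sqrf_eq0 eq_le sqr_ge0 andbT.
by rewrite (le_trans (mx_norm_sqr_le_inner u)) ?u0.
Qed.

Lemma inner_Cauchy_Schwarz u v : inner u v ^+ 2 <= inner u u * inner v v.
Proof.
have [/inner_eq0 ->|v0] := eqVneq (inner v v) 0.
  by rewrite -(scale0r (0 : 'rV[R]_n)) !innerE !mul0r expr0n mulr0.
have vv : 0 < inner v v by rewrite lt_neqAle eq_sym v0 inner_ge0.
(* Multiplied by [inner v v], the difference of the two sides is the squared length of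
   [inner v v *: u - inner u v *: v]. *)
rewrite -subr_ge0 -(pmulr_rge0 _ vv).
rewrite (_ : _ * (_ - _) = inner (inner v v *: u - inner u v *: v)
                           (inner v v *: u - inner u v *: v)) ?inner_ge0//.
by rewrite !innerE (innerC v u); ring.
Qed.

Lemma cvg_inner (T : Type) (F : set_system T) {FF : Filter F}
    (f g : T -> 'rV[R]_n) u v :
  f @ F --> u -> g @ F --> v -> inner (f x) (g x) @[x --> F] --> inner u v.
Proof.
move=> fu gv; apply: cvg_big => [|i _]; first exact: add_continuous.
apply: cvgM.
  by apply: (cvg_comp f (fun w : 'rV[R]_n => w 0 i) fu); exact: coord_continuous.
by apply: (cvg_comp g (fun w : 'rV[R]_n => w 0 i) gv); exact: coord_continuous.
Qed.

End InnerProduct.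

Section ConvexNormals.
Context {R : realType} {n : nat}.
Implicit Types (A : set 'rV[R]_n) (x y z d v : 'rV[R]_n).

Lemma convex_set_segment A x y (l : R) : convex_set A -> A x -> A y ->
  0 <= l -> l <= 1 -> A (x + l *: (y - x)).
Proof.
move=> cA Ax Ay l0 l1.
have /set_mem := cA y x (Itv01 l0 l1) (mem_set Ay) (mem_set Ax).
rewrite /conv /= /unstable.onem; congr A.
by rewrite scalerBl scale1r scalerBr addrCA.
Qed.

(** Along the segment from [z] to [y] the inner product is linear in the parameter [l] while the
    remainder is o(l), so convexity removes the remainder. *)
Lemma regular_normal_coneP A z v : convex_set A ->
  regular_normal_cone A z v <->
  A z /\ forall y, A y -> inner v (y - z) <= 0.
Proof.
move=> cA; split=> [[Az [ o /eqoP o0 vo]]|[Az vA]]; split=> //; last first.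
  exists (fun=> 0); last exact: vA.
  by apply/eqoP => e e0; apply: nearW => x; rewrite normr0 mulr_ge0 // ltW.
move=> y Ay; set r := enorm (y - z).
have r0 : 0 <= r by rewrite sqrtr_ge0.
have rE (l : R) : 0 <= l -> enorm (l *: (y - z)) = l * r.
  move=> l0; rewrite /r /enorm innerZl innerZr mulrA -expr2 sqrtrM ?sqr_ge0//.
  by rewrite sqrtr_sqr ger0_norm.
have [r00|rN0] := eqVneq r 0.
  have -> : y - z = 0.
    apply: inner_eq0; apply/eqP; rewrite eq_le inner_ge0 andbT.
    by rewrite -sqrtr_eq0; apply/eqP.
  by rewrite -(scale0r (0 : 'rV[R]_n)) innerE mul0r.
have rp : 0 < r by rewrite lt_neqAle eq_sym rN0.
apply/ler_addgt0Pl => e e0; rewrite addr0.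
(* Take [l = h / r] with [h < r] so small that [o h] is at most [e / r * h]; dividing by [l] then
   leaves the bound [e]. *)
have [l [l0 l1 ol]] : exists l : R, [/\ 0 < l, l <= 1 & o (l * r) <= e / r * (l * r)].
  have : \forall h \near (0 : R)^'+, [/\ 0 < h, h < r & `|o h| <= e / r * `|h|].
    near=> h; split; near: h; [exact: nbhs_right_gt|exact: nbhs_right_lt|].
    by apply: o0; rewrite divr_gt0.
  move=> /(@filter_ex _ _ _)[h [h0 hr oh]]; exists (h / r).
  rewrite divr_gt0// ler_pdivrMr// mul1r ltW// divfK//; split=> //.
  by rewrite (le_trans (ler_norm _))// -[in leRHS](gtr0_norm h0).
have := vo _ (convex_set_segment cA Az Ay (ltW l0) l1).
rewrite (addrC z) addrK (rE _ (ltW l0)) innerZr => /le_trans /(_ ol).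
by rewrite mulrCA divfK// ler_pM2l.
Unshelve. all: by end_near.
Qed.

Lemma closed_nearest_point A x : closed A -> A !=set0 ->
  exists2 p, A p & forall y, A y -> inner (x - p) (x - p) <= inner (x - y) (x - y).
Proof.
move=> clA [a Aa]; set f := fun y => inner (x - y) (x - y).
have cf : continuous f.
  move=> y; have xy : x - w @[w --> y] --> x - y.
    by apply: (@cvgB R 'rV[R]_n _ (nbhs y)); [exact: cvg_cst|exact: cvg_id].
  exact: (cvg_inner xy xy).
set B := A `&` [set y | f y <= f a].
have Ba : B a by split => /=.
have clB : closed B.
  by apply: closedI => //; apply: (preimage_closed _ (@closed_le _ _)) => y _; exact: cf.
have bB : bounded_set B.
  (* From [(s - 1)^2 >= 0] and [s^2 <= f a], where [s] is the norm of [x - y], follows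
     [2 s <= f a + 1]; no square root is needed. *)
  exists (`|x| + (f a + 1)); split; first exact: num_real.
  move=> M /ltW xM y [_ fy]; apply: le_trans xM.
  rewrite -[y](subKr x) (le_trans (ler_normB _ _))// lerD2l.
  have := le_trans (mx_norm_sqr_le_inner (x - y)) fy.
  have := sqr_ge0 (`|x - y| - 1); have := normr_ge0 (x - y); rewrite -/(f a).
  nra.
have [|p /set_mem[Ap pa] pmin] := @compact_EVT_min _ _ f B (ex_intro _ a Ba)
    (bounded_closed_compact bB clB).
  exact: continuous_subspaceT.
exists p => // y Ay; have [yB|yB] := leP (f y) (f a).
  by apply: pmin; apply/mem_set.
exact: le_trans pa (ltW yB).
Qed.

(** If the inner product [c] were positive, a step [l] from the nearest point [p] towards [y] would
    change the squared distance by [l^2 b - 2 l c]. For [l = c / (b + c)] this is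
    [- l c (1 + l) < 0], and [l] lies in (0, 1]. *)
Lemma convex_projection A x : closed A -> convex_set A -> A !=set0 ->
  exists2 p, A p & forall y, A y -> inner (x - p) (y - p) <= 0.
Proof.
move=> clA cA A0; have [p Ap pmin] := closed_nearest_point x clA A0.
exists p => // y Ay; rewrite leNgt; apply/negP => c0.
set c := inner _ _ in c0; set b := inner (y - p) (y - p).
have b0 : 0 <= b by exact: inner_ge0.
have bc : 0 < b + c by lra.
have l0 : 0 < c / (b + c) by rewrite divr_gt0.
have l1 : c / (b + c) <= 1 by rewrite ler_pdivrMr// mul1r lerDr.
have lbc : c / (b + c) * (b + c) = c by rewrite divfK ?gt_eqF.
set l := c / (b + c) in l0 l1 lbc.
have := pmin _ (convex_set_segment cA Ap Ay (ltW l0) l1).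
rewrite opprD addrA [in leRHS]innerDl !(innerDr (x - p)) (innerDr (- _)).
rewrite !(innerNl, innerNr, innerZl, innerZr) (innerC (y - p)) -/b -/c.
nra.
Qed.

(* To be read with p the projection of d + v onto a convex set containing 0 and q. *)
Lemma projection_estimate d v p q :
  inner v (p - d) <= 0 ->
  inner (d + v - p) (q - p) <= 0 ->
  inner (d + v - p) (0 - p) <= 0 ->
  inner (p - d) (p - d) ^+ 2 <= inner (d + v) (d + v) * inner (q - d) (q - d).
Proof.
(* The hypothesis [w0] says that [inner w p >= 0], so expanding [d + v = w + p] bounds [w]. *)
move=> vp wq w0; set w := d + v - p.
have ww : inner w w <= inner (d + v) (d + v).
  have -> : d + v = w + p by rewrite subrK.
  move: w0; rewrite -/w sub0r innerNr oppr_le0 => w0; clearbody w.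
  by have := inner_ge0 p; rewrite !innerDl !innerDr (innerC p w); lra.
(* Split [d - q] as [(d - p) + (p - q)]: the second part contributes a nonnegative term by [wq], the
   first [inner (p - d) (p - d) - inner v (p - d)]. *)
have dp : inner (p - d) (p - d) <= inner w (d - q).
  move: vp wq; rewrite /w !innerE (innerC p d) (innerC v p) (innerC v d).
  lra.
apply: (@le_trans _ _ (inner w (d - q) ^+ 2)).
  by rewrite ler_sqr ?nnegrE ?inner_ge0// (le_trans (inner_ge0 _) dp).
apply: le_trans (inner_Cauchy_Schwarz _ _) _.
by rewrite -(opprB q d) innerNl innerNr opprK ler_wpM2r ?inner_ge0.
Qed.

(** One concrete sequence decreasing to 0 suffices to specialise the universal quantifier. *)
Lemma inner_dir_normal_cone_sub A z d :
  inner_dir_normal_cone A z d `<=` dir_normal_cone A z d.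
Proof.
move=> v /(_ harmonic)[|dk [vk [? ? ?]]].
  by split=> [k|]; [exact: harmonic_gt0|exact: cvg_harmonic].
exists harmonic, dk, vk; split=> //.
by split=> [k|]; [exact: harmonic_gt0|exact: cvg_harmonic].
Qed.

Lemma dir_normal_cone_sub_inner A z d : closed A -> convex_set A -> A z ->
  dir_normal_cone A z d `<=` inner_dir_normal_cone A z d.
Proof.
move=> clA cA Az v [t [dk [vk [[t0 tcvg] dkd vkv nk]]]] s [s0 scvg].
(* This is the monotonicity of the rescaled sets (A - z)/s: the new point has parameter [b / a] on
   the segment from [z]. *)
have shrink y (a b : R) : 0 < b -> b <= a -> A (z + a *: y) -> A (z + b *: y).
  move=> b0 ba Aa; have a0 := lt_le_trans b0 ba.
  have ba1 : b / a <= 1 by rewrite ler_pdivrMr// mul1r.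
  have := convex_set_segment cA Az Aa (ltW (divr_gt0 b0 a0)) ba1.
  by rewrite (addrC z (a *: y)) addrK scalerA divfK ?gt_eqF.
have near_le (u : R^nat) (a : R) : u @ \oo --> (0 : R) -> 0 < a ->
    \forall k \near \oo, u k <= a.
  by move=> /cvgr_le u0 a0; exact: u0.
(* [P] is the projection of [z + s j *: (d + v)] onto [A]; rescaling about [z] divides its
   variational inequality by [s j] twice. *)
have /choice[p pP] : forall j, exists pj, A (z + s j *: pj) /\
    forall y, A (z + s j *: y) -> inner (d + v - pj) (y - pj) <= 0.
  move=> j; have [P AP Pmin] :=
    convex_projection (z + s j *: (d + v)) clA cA (ex_intro _ z Az).
  have sj := s0 j; have sjN : s j != 0 by rewrite gt_eqF.
  have PE : P = z + s j *: ((s j)^-1 *: (P - z)).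
    by rewrite scalerA divff// scale1r addrC subrK.
  exists ((s j)^-1 *: (P - z)); rewrite -PE; split=> // y /Pmin.
  rewrite [in X in X -> _]PE !opprD !addrA.
  rewrite ![_ + _ - z]addrAC !subrr !add0r -!scalerBr innerZl innerZr.
  by rewrite !pmulr_rle0.
(* Here [j] is fixed and [k] grows: once [t k <= s j], the point [z + t k *: p j] lies in [A] and
   can be tested against the normal [vk k]. *)
have vp j : inner v (p j - d) <= 0.
  have pdk : p j - dk k @[k --> \oo] --> p j - d by exact: (cvgB (cvg_cst (p j)) dkd).
  apply: (cvgr_to_le (cvg_inner vkv pdk)).
  have := near_le _ _ tcvg (s0 j); apply: filterS => k tk.
  have [_ /(_ _ (shrink _ _ _ (t0 k) tk (pP j).1))] := (regular_normal_coneP _ _ cA).1 (nk k).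
  rewrite opprD addrA [_ + _ - z]addrAC subrr add0r -scalerBr innerZr.
  by rewrite pmulr_rle0.
(* Now [k] is fixed and [j] grows: once [s j <= t k], both [dk k] and 0 are admissible tests for the
   projection [p j]. *)
have est k : \forall j \near \oo,
    inner (p j - d) (p j - d) ^+ 2 <= inner (d + v) (d + v) * inner (dk k - d) (dk k - d).
  have := near_le _ _ scvg (t0 k); apply: filterS => j sj.
  have [_ pj] := pP j; apply: projection_estimate; first exact: vp.
    by apply: pj; apply: shrink (s0 j) sj _; case: (nk k).
  by apply: pj; rewrite scaler0 addr0.
have pd : p @ \oo --> d.
  apply/cvgrPdist_lt => e e0.
  have : inner (d + v) (d + v) * inner (dk k - d) (dk k - d) @[k --> \oo] --> (0 : R).
    rewrite -(mulr0 (inner (d + v) (d + v))); apply: cvgM; first exact: cvg_cst.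
    have -> : 0 = inner (d - d) (d - d) :> R.
      by rewrite subrr -(scale0r (0 : 'rV[R]_n)) innerZl mul0r.
    have dkd0 : dk k - d @[k --> \oo] --> d - d by exact: (cvgB dkd (cvg_cst d)).
    exact: (cvg_inner dkd0 dkd0).
  (* The threshold is [e ^+ 4] because [est] controls the fourth power of the distance from [p j] to
     [d]; [k] is fixed first, then [j] is taken large. *)
  move=> /cvgr_lt /(_ (e ^+ 4)); rewrite exprn_gt0// => /(_ isT).
  move=> /(@filter_ex _ _ _)[k ke].
  have := est k; apply: filterS => j /le_lt_trans /(_ ke) pj.
  rewrite distrC -(@ltr_pXn2r _ 4) ?nnegrE ?normr_ge0 ?(ltW e0)//.
  apply: le_lt_trans pj; rewrite (exprM _ 2 2) ler_sqr ?nnegrE ?inner_ge0 ?sqr_ge0//.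
  exact: mx_norm_sqr_le_inner.
exists p, (fun j => d + v - p j); split=> //.
  have vE : d + v - d = v by rewrite addrC addKr.
  rewrite -[X in _ --> X]vE.
  exact: (cvgB (cvg_cst (d + v)) pd).
(* Scaled back by [s j], the variational inequality of [p j] is exactly the convex form of
   normality. *)
move=> j; apply/regular_normal_coneP => //; have [Aj pj] := pP j; split=> // y Ay.
have sjN : s j != 0 by rewrite gt_eqF.
have yE : y = z + s j *: ((s j)^-1 *: (y - z)).
  by rewrite scalerA divff// scale1r addrC subrK.
rewrite yE opprD addrA [_ + _ - z]addrAC subrr add0r -scalerBr innerZr.
by rewrite pmulr_rle0//; apply: pj; rewrite -yE.
Qed.

End ConvexNormals.

Theorem proposition3p5 (R : realType) (n : nat) (A : set 'rV[R]_n)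
  (clA : closed A) (cvxA : convex_set A) : directionally_regular A.
Proof.
move=> z d Az; apply/seteqP; split; first exact: dir_normal_cone_sub_inner.
exact: inner_dir_normal_cone_sub.
Qed.
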